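(* Let $\alpha_5,\beta_5,\alpha_6,\beta_6$ be real numbers. The double inequalities $$Q^{\alpha_{5}}(a,b)\,A^{1-\alpha_{5}}(a,b)<N_{AQ}(a,b)<Q^{\beta_{5}}(a,b)\,A^{1-\beta_{5}}(a,b),$$ $$\frac{\alpha_{6}}{A(a,b)}+\frac{1-\alpha_{6}}{Q(a,b)}<\frac{1}{N_{AQ}(a,b)}<\frac{\beta_{6}}{A(a,b)}+\frac{1-\beta_{6}}{Q(a,b)}$$ hold for all $a,b>0$ with $a\neq b$ if and only if $\alpha_{5}\leq 2/3$, $\beta_{5}\geq \dfrac{2\log(\pi+2)}{\log 2}-4=0.7244\ldots$, $\alpha_{6}\leq \dfrac{6+2\sqrt{2}-(1+\sqrt{2})\pi}{\pi+2}=0.2419\ldots$ and $\beta_{6}\geq 1/3$.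
   Context: For $a,b>0$, $A(a,b)=(a+b)/2$ and $Q(a,b)=\sqrt{(a^{2}+b^{2})/2}$ are the arithmetic and quadratic means; $Q^{p}(a,b)$ means $(Q(a,b))^{p}$, and similarly for $A$. For $a,b>0$ with $a\ne b$, the Schwab-Borchardt mean is $$SB(a,b)=\begin{cases}\dfrac{\sqrt{b^2-a^2}}{\cos^{-1}(a/b)}, & a<b,\\[2mm] \dfrac{\sqrt{a^2-b^2}}{\cosh^{-1}(a/b)}, & a>b,\end{cases}$$ where $\cos^{-1}$ is the inverse cosine and $\cosh^{-1}(x)=\log(x+\sqrt{x^2-1})$ is the inverse hyperbolic cosine. The Neuman mean is $N(a,b)=\frac12\left(a+\frac{b^{2}}{SB(a,b)}\right)$, and $N_{AQ}(a,b)=N(A(a,b),Q(a,b))$ for $a\neq b$. Here $\log$ is the natural logarithm. *)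

(* Defs.v *)
From Stdlib Require Import Reals.
Open Scope R_scope.

Definition arith_mean (a b : R) : R := (a + b) / 2.

Definition quad_mean (a b : R) : R := sqrt ((a ^ 2 + b ^ 2) / 2).

Definition arccosh (x : R) : R := ln (x + sqrt (x ^ 2 - 1)).

(* Only meaningful for a, b > 0 with a <> b; the last value is a placeholder
   on the diagonal a = b, where the mean is left undefined. *)
Definition SB (a b : R) : R :=
  match total_order_T a b with
  | inleft (left _) => sqrt (b ^ 2 - a ^ 2) / acos (a / b)
  | inleft (right _) => 0
  | inright _ => sqrt (a ^ 2 - b ^ 2) / arccosh (a / b)
  end.

Definition neuman_mean (a b : R) : R := / 2 * (a + b ^ 2 / SB a b).

Definition N_AQ (a b : R) : R := neuman_mean (arith_mean a b) (quad_mean a b).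

(* Main.v *)
Require Import Defs.
From Stdlib Require Import Reals Machin Lra.
From Coquelicot Require Import Coquelicot.
Open Scope R_scope.

(** Write A/Q = cos (x/2).  As (a, b) varies, [x] runs through (0, PI / 2), and
    N/A becomes [neuman_ratio x], that is, (1 + x / sin x) / 2
    ([mean_inequalities_iff]).  The theorem asks for the range on (0, PI / 2) of the
    two quotients
    ln (N/A) / ln (Q/A)  and  (A/N - A/Q) / (1 - A/Q).
    The first has the limits 2/3 and [log_exponent_sup] at 0 and at [PI / 2], the
    second the limits 1/3 and [recip_weight_inf]; the claim is that each quotient
    lies strictly between its two limits.

    The bounds that come from the end [x = 0] are direct: the first quotient exceeds
    2/3 because the quotient of the derivatives does ([log_lower_bound]), and
    [recip_upper_bound] follows from a lower bound for N/A.  For those that come from the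
    other end ([log_upper_bound], [recip_lower_bound]), the difference of the two
    sides vanishes at both ends of the interval, and its derivative has the sign of
    G - c with c constant and G the quotient of two derivatives, [log_slope] or
    [recip_slope].  When G increases, the difference decreases first and increases
    afterwards, hence is negative ([neg_of_single_crossing]).  In both cases the sign
    of G' is that of a quadratic polynomial in sin x / x, concave with positive
    constant term, and the Cusa-Huygens inequality sin x / x < (2 + cos x) / 3
    suffices: at this bound the polynomial is a positive multiple of (1 - cos x)^2.

    Conversely, constants valid for all [x] are valid in the limit.  At [PI / 2] this
    is continuity; at 0 the inequality [sin_lower] gives a rational upper bound for
    N/A that is exact to second order. *)

(** * Sign of a function from its derivative *)

Lemma pos_of_derive_pos (f df : R -> R) (m x : R) :
  (forall y, 0 <= y < m -> is_derive f y (df y)) ->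
  (forall y, 0 < y < m -> 0 < df y) ->
  f 0 = 0 -> 0 < x < m -> 0 < f x.
Proof.
  intros Hd Hpos Hf0 Hx.
  destruct (MVT_cor2 f df 0 x) as [c [Hc Hcx]].
  - lra.
  - intros c Hc. apply is_derive_Reals, Hd. lra.
  - rewrite Hf0 in Hc.
    assert (0 < df c * (x - 0)) by (apply Rmult_lt_0_compat; [apply Hpos|]; lra).
    lra.
Qed.

Lemma incr_of_derive_pos (f df : R -> R) (m x y : R) :
  (forall z, 0 < z < m -> is_derive f z (df z)) ->
  (forall z, 0 < z < m -> 0 < df z) ->
  0 < x -> x < y -> y < m -> f x < f y.
Proof.
  intros Hd Hpos Hx Hxy Hy.
  apply (incr_function f 0 m df); simpl; intros; try apply Hd; try apply Hpos; lra.
Qed.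

(** The counterpart for increasing functions whose lower limit at 0 is
    nonnegative. *)
Lemma pos_of_incr (f : R -> R) (m x : R) :
  (forall y z, 0 < y -> y < z -> z < m -> f y < f z) ->
  (forall eps, 0 < eps -> exists d, 0 < d /\ forall y, 0 < y < d -> - eps < f y) ->
  0 < x < m -> 0 < f x.
Proof.
  intros Hincr Hlim Hx.
  destruct (Rlt_le_dec 0 (f x)) as [|Hneg]; auto.
  assert (H2 : f (x / 2) < f x) by (apply Hincr; lra).
  destruct (Hlim (- f (x / 2))) as [d [Hd Hy]]; [lra|].
  set (y := Rmin d x / 4).
  assert (0 < y < d /\ y < x / 2).
  { unfold y, Rmin. destruct (Rle_dec d x); lra. }
  specialize (Hy y ltac:(lra)).
  assert (f y < f (x / 2)) by (apply Hincr; lra). lra.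
Qed.

(** An increasing [G] makes the derivative [w * (G - c)] change sign at most
    once, from negative to positive, so [f] first decreases and then increases:
    starting from a limit that is at most 0 and ending at 0, it stays negative
    in between.  The limit at 0 is an epsilon condition because the functions of
    interest contain [x / sin x], which is not given its limit value there. *)
Lemma neg_of_single_crossing (f w G : R -> R) (c m x : R) :
  (forall y, 0 < y <= m -> is_derive f y (w y * (G y - c))) ->
  (forall y, 0 < y < m -> 0 < w y) ->
  (forall y z, 0 < y -> y < z -> z < m -> G y < G z) ->
  (forall eps, 0 < eps -> exists d, 0 < d /\ forall y, 0 < y < d -> f y < eps) ->
  f m = 0 -> 0 < x < m -> f x < 0.
Proof.
  intros Hd Hw HG Hlim Hm Hx.
  destruct (Rlt_le_dec (f x) 0) as [|Hpos]; auto. exfalso.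
  destruct (MVT_cor2 f (fun y => w y * (G y - c)) x m) as [xi [Hxi Hxim]].
  - lra.
  - intros y Hy. apply is_derive_Reals, Hd. lra.
  - assert (HGxi : G xi <= c).
    { destruct (Rle_lt_dec (G xi) c) as [|Hgt]; auto.
      assert (0 < w xi * (G xi - c) * (m - x)).
      { repeat apply Rmult_lt_0_compat; try apply Hw; lra. }
      lra. }
    assert (Hdecr : forall y z, 0 < y -> y < z -> z < xi -> - f y < - f z).
    { intros y z Hy Hyz Hz.
      apply (incr_of_derive_pos (fun t => - f t)
               (fun t => - (w t * (G t - c))) xi); auto.
      - intros t Ht. apply (is_derive_opp f), Hd. lra.
      - intros t Ht.
        assert (G t < G xi) by (apply HG; lra).
        assert (0 < w t * (c - G t)) by (apply Rmult_lt_0_compat; [apply Hw|]; lra).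
        lra. }
    assert (H1 : - f (x / 2) < - f x) by (apply Hdecr; lra).
    destruct (Hlim (f (x / 2))) as [d [Hd0 Hy]]; [lra|].
    set (y := Rmin d x / 4).
    assert (0 < y < d /\ y < x / 2).
    { unfold y, Rmin. destruct (Rle_dec d x); lra. }
    specialize (Hy y ltac:(lra)).
    assert (- f y < - f (x / 2)) by (apply Hdecr; lra). lra.
Qed.

Lemma nonpos_at_endpoint (f : R -> R) (m l : R) : 0 < m ->
  is_derive f m l -> (forall x, 0 < x < m -> f x < 0) -> f m <= 0.
Proof.
  intros Hm Hd Hf.
  destruct (Rle_lt_dec (f m) 0) as [|Hpos]; auto. exfalso.
  assert (Hc : continuity_pt f m).
  { apply derivable_continuous_pt. exists l. now apply is_derive_Reals. }
  destruct (Hc (f m)) as (d & Hd0 & Hnear); [lra|].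
  set (x := m - Rmin d m / 2).
  assert (0 < Rmin d m) by (apply Rmin_pos; lra).
  pose proof (Rmin_l d m). pose proof (Rmin_r d m).
  assert (Hx : 0 < x < m) by (unfold x; lra).
  assert (Habs : Rabs (f x - f m) < f m).
  { apply (Hnear x). split.
    - split; [exact I | lra].
    - simpl. unfold R_dist. rewrite Rabs_left; unfold x; lra. }
  specialize (Hf x Hx). apply Rabs_def2 in Habs. lra.
Qed.

(** * Inequalities for sin x / x *)

Lemma sin_pos x : 0 < x < PI -> 0 < sin x.
Proof. intros; apply sin_gt_0; lra. Qed.

Lemma mul_cos_lt_sin x : 0 < x < PI -> x * cos x < sin x.
Proof.
  intros Hx. apply Rminus_lt_0.
  apply (pos_of_derive_pos (fun y => sin y - y * cos y) (fun y => y * sin y) PI); auto.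
  - intros y _. auto_derive; auto. ring.
  - intros y Hy. apply Rmult_lt_0_compat; [lra | now apply sin_pos].
  - rewrite sin_0; ring.
Qed.

(** The Cusa-Huygens inequality: two differentiations of the difference lead to
    [sin y - y * cos y], which is positive. *)
Lemma cusa_huygens x : 0 < x < PI -> 3 * sin x < x * (2 + cos x).
Proof.
  intros Hx. apply Rminus_lt_0.
  apply (pos_of_derive_pos (fun y => y * (2 + cos y) - 3 * sin y)
           (fun y => 2 - 2 * cos y - y * sin y) PI); auto.
  - intros y _. auto_derive; auto. ring.
  - intros z Hz.
    apply (pos_of_derive_pos (fun y => 2 - 2 * cos y - y * sin y)
             (fun y => sin y - y * cos y) PI); auto.
    + intros y _. auto_derive; auto. ring.
    + intros y Hy. pose proof (mul_cos_lt_sin y Hy). lra.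
    + rewrite cos_0; ring.
  - rewrite sin_0; ring.
Qed.

Lemma cusa_ratio x : 0 < x < PI -> 0 < sin x / x < (2 + cos x) / 3.
Proof.
  intros Hx. pose proof (sin_pos x Hx). pose proof (cusa_huygens x Hx).
  split; [apply Rdiv_lt_0_compat; lra|]. apply <- Rlt_div_l; lra.
Qed.

(** The companion of the Cusa-Huygens inequality in the other direction; the
    difference has the derivative [2 * sin y * (y - sin y)]. *)
Lemma sin_lower x : 0 < x < PI -> x * (1 + 2 * cos x) < sin x * (2 + cos x).
Proof.
  intros Hx. apply Rminus_lt_0.
  apply (pos_of_derive_pos (fun y => sin y * (2 + cos y) - y * (1 + 2 * cos y))
           (fun y => 2 * sin y * (y - sin y)) PI); auto.
  - intros y _. auto_derive; auto.
    pose proof (sin2_cos2 y). unfold Rsqr in *. nra.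
  - intros y Hy. pose proof (sin_lt_x y). pose proof (sin_pos y Hy).
    apply Rmult_lt_0_compat; lra.
  - rewrite sin_0; ring.
Qed.

(** * Numerical values of the constants *)

Definition log_exponent_sup := 2 * ln (PI + 2) / ln 2 - 4.

Definition recip_weight_inf := (6 + 2 * sqrt 2 - (1 + sqrt 2) * PI) / (PI + 2).

(** Partial sums of the Machin-type series
    [PI / 4 = 2 * atan (1 / 3) + atan (1 / 7)]. *)
Lemma PI_approx : 314156 / 100000 < PI < 314160 / 100000.
Proof.
  pose proof (PI_2_3_7_ineq 3) as H.
  unfold tg_alt, PI_2_3_7_tg, Ratan_seq in H. simpl in H. lra.
Qed.

Lemma ln2_pos : 0 < ln 2.
Proof. rewrite <- ln_1. apply ln_increasing; lra. Qed.

(** Turns a comparison of powers of decimals into one of integers, which can be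
    decided by computation. *)
Lemma pow_frac (p q : Z) (n : nat) : (0 < q)%Z ->
  (IZR p / IZR q) ^ n = IZR (p ^ Z.of_nat n) / IZR (q ^ Z.of_nat n).
Proof.
  intros Hq. rewrite <- !pow_IZR. unfold Rdiv.
  rewrite Rpow_mult_distr, pow_inv. reflexivity.
Qed.

(** The ratio [ln (PI + 2) / ln 2] is 2.362215...; 300/127 and 463/196 are
    fractions with small denominators on either side of it, close enough for the
    four decimals wanted.  With them the bounds become comparisons of integer
    powers. *)
Lemma log2_bounds : 300 / 127 * ln 2 < ln (PI + 2) < 463 / 196 * ln 2.
Proof.
  pose proof PI_approx.
  assert (H1 : ln (2 ^ 300) < ln ((PI + 2) ^ 127)).
  { apply ln_increasing; [apply pow_lt; lra|].
    apply Rlt_le_trans with ((514156 / 100000) ^ 127).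
    - rewrite pow_frac, pow_IZR by reflexivity. apply -> Rlt_div_r.
      + rewrite <- mult_IZR. apply IZR_lt. vm_compute. reflexivity.
      + apply (IZR_lt 0). reflexivity.
    - apply pow_incr; lra. }
  assert (H2 : ln ((PI + 2) ^ 196) < ln (2 ^ 463)).
  { apply ln_increasing; [apply pow_lt; lra|].
    apply Rle_lt_trans with ((514160 / 100000) ^ 196).
    - apply pow_incr; lra.
    - rewrite pow_frac, pow_IZR by reflexivity. apply <- Rlt_div_l.
      + rewrite <- mult_IZR. apply IZR_lt. vm_compute. reflexivity.
      + apply (IZR_lt 0). reflexivity. }
  rewrite !ln_pow in H1, H2 by lra.
  rewrite !INR_IZR_INZ in H1, H2. simpl in H1, H2. lra.
Qed.

Lemma log_exponent_sup_bounds : 7244 / 10000 <= log_exponent_sup < 7245 / 10000.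
Proof.
  unfold log_exponent_sup. pose proof ln2_pos. pose proof log2_bounds.
  replace (2 * ln (PI + 2) / ln 2) with (2 * (ln (PI + 2) / ln 2)) by (field; lra).
  assert (300 / 127 < ln (PI + 2) / ln 2) by (apply -> Rlt_div_r; lra).
  assert (ln (PI + 2) / ln 2 < 463 / 196) by (apply <- Rlt_div_l; lra).
  lra.
Qed.

Lemma sqrt2_approx : 1414213 / 1000000 < sqrt 2 < 1414214 / 1000000.
Proof.
  pose proof (sqrt_def 2 ltac:(lra)). pose proof (sqrt_pos 2). split; nra.
Qed.

Lemma inv_sqrt2_bounds : 707 / 1000 < / sqrt 2 < 708 / 1000.
Proof.
  pose proof sqrt2_approx. split.
  - apply Rmult_lt_reg_r with (sqrt 2); [lra|]. rewrite Rinv_l; lra.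
  - apply Rmult_lt_reg_r with (sqrt 2); [lra|]. rewrite Rinv_l; lra.
Qed.

Lemma recip_weight_inf_bounds :
  2419 / 10000 <= recip_weight_inf < 2420 / 10000.
Proof.
  unfold recip_weight_inf. pose proof PI_approx. pose proof sqrt2_approx.
  split.
  - apply -> Rle_div_r; nra.
  - apply <- Rlt_div_l; nra.
Qed.

(** * Reduction to one angle *)

Lemma half_cos_sqr x : cos x = 2 * cos (x / 2) ^ 2 - 1.
Proof. replace x with (2 * (x / 2)) at 1 by field. rewrite cos_2a_cos. ring. Qed.

Lemma half_sin_cos x : sin x = 2 * sin (x / 2) * cos (x / 2).
Proof. replace x with (2 * (x / 2)) at 1 by field. apply sin_2a. Qed.

Lemma sin2_cos2_pow x : sin x ^ 2 + cos x ^ 2 = 1.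
Proof. pose proof (sin2_cos2 x). unfold Rsqr in *. lra. Qed.

(** The value of N/A when A/Q = cos (x/2): there Q / SB(A,Q) is
    (x/2) / sin (x/2), and the duplication formula gives this quotient. *)
Definition neuman_ratio (x : R) : R := (1 + x / sin x) / 2.

Lemma neuman_ratio_gt_1 x : 0 < x < PI -> 1 < neuman_ratio x.
Proof.
  intros Hx. pose proof (sin_pos x Hx). pose proof (sin_lt_x x (proj1 Hx)).
  assert (1 < x / sin x) by (apply -> Rlt_div_r; lra).
  unfold neuman_ratio. lra.
Qed.

Lemma arith_mean_pos a b : 0 < a -> 0 < b -> 0 < arith_mean a b.
Proof. unfold arith_mean; lra. Qed.

Lemma neuman_mean_polar A x : 0 < A -> 0 < x < PI ->
  neuman_mean A (A / cos (x / 2)) = A * neuman_ratio x.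
Proof.
  intros HA Hx.
  assert (Hs : 0 < sin (x / 2)) by (apply sin_pos; lra).
  assert (Hc : 0 < cos (x / 2)) by (apply cos_gt_0; lra).
  pose proof (sin2_cos2_pow (x / 2)) as Hsc.
  assert (Hc1 : cos (x / 2) < 1) by nra.
  assert (HAQ : A < A / cos (x / 2)) by (apply -> Rlt_div_r; nra).
  unfold neuman_mean, SB, neuman_ratio.
  destruct (total_order_T A (A / cos (x / 2))) as [[_|H]|H]; try lra.
  replace ((A / cos (x / 2)) ^ 2 - A ^ 2)
    with ((A * sin (x / 2) / cos (x / 2)) ^ 2).
  2: { replace ((A * sin (x / 2) / cos (x / 2)) ^ 2)
         with (A ^ 2 * sin (x / 2) ^ 2 / cos (x / 2) ^ 2) by (field; lra).
       replace (sin (x / 2) ^ 2) with (1 - cos (x / 2) ^ 2) by lra. field. lra. }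
  rewrite sqrt_pow2.
  2: { apply Rlt_le, Rdiv_lt_0_compat; nra. }
  replace (A / (A / cos (x / 2))) with (cos (x / 2)) by (field; lra).
  rewrite acos_cos by lra.
  rewrite (half_sin_cos x). field. lra.
Qed.

(** The bound [x < PI / 2] is Q < sqrt 2 * A, that is, 0 < a b. *)
Lemma means_polar a b : 0 < a -> 0 < b -> a <> b ->
  exists x, 0 < x < PI / 2 /\ quad_mean a b = arith_mean a b / cos (x / 2).
Proof.
  intros Ha Hb Hab.
  assert (HA := arith_mean_pos a b Ha Hb).
  set (A := arith_mean a b) in *. set (Q := quad_mean a b).
  assert (HQ2 : Q * Q = (a ^ 2 + b ^ 2) / 2) by (apply sqrt_def; nra).
  assert (HQ0 : 0 <= Q) by apply sqrt_pos.
  assert (HA2 : A = (a + b) / 2) by reflexivity.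
  assert (0 < (a - b) ^ 2) by (apply pow2_gt_0; lra).
  assert (HAQ : A < Q) by nra.
  assert (Hs2 : 0 < sqrt 2) by (apply sqrt_lt_R0; lra).
  assert (Hs22 : sqrt 2 * sqrt 2 = 2) by (apply sqrt_def; lra).
  assert (HQA : Q < sqrt 2 * A).
  { assert (Q * Q < (sqrt 2 * A) * (sqrt 2 * A)).
    { replace (sqrt 2 * A * (sqrt 2 * A)) with ((sqrt 2 * sqrt 2) * (A * A)) by ring.
      rewrite Hs22. nra. }
    assert (0 < sqrt 2 * A) by nra. nra. }
  assert (Hk : A / Q < 1) by (apply <- Rlt_div_l; lra).
  assert (Hk0 : / sqrt 2 < A / Q).
  { apply -> Rlt_div_r; [|lra]. rewrite Rmult_comm.
    apply <- (Rlt_div_l Q A (sqrt 2)); lra. }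
  assert (Hk1 : 0 < / sqrt 2) by now apply Rinv_0_lt_compat.
  assert (Hcos : cos (acos (A / Q)) = A / Q) by (apply cos_acos; lra).
  pose proof (acos_bound (A / Q)) as Hb'.
  exists (2 * acos (A / Q)).
  replace (2 * acos (A / Q) / 2) with (acos (A / Q)) by field.
  rewrite Hcos. split; [|field; lra].
  assert (acos (A / Q) <> 0) by (intros E; rewrite E, cos_0 in Hcos; lra).
  assert (acos (A / Q) < PI / 4).
  { pose proof PI_RGT_0. apply cos_decreasing_0; try lra.
    rewrite Hcos, cos_PI4. unfold Rdiv. lra. }
  lra.
Qed.

Lemma polar_means x : 0 < x < PI / 2 ->
  exists a b, 0 < a /\ 0 < b /\ a <> b /\
    arith_mean a b = 1 /\ quad_mean a b = 1 / cos (x / 2).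
Proof.
  intros Hx.
  assert (Hs : 0 < sin (x / 2)) by (apply sin_pos; lra).
  assert (Hc : 0 < cos (x / 2)) by (apply cos_gt_0; lra).
  assert (Ht : 0 < tan (x / 2)) by now apply Rdiv_lt_0_compat.
  assert (Ht1 : tan (x / 2) < 1).
  { rewrite <- tan_PI4. apply tan_increasing; lra. }
  (* tan (x/2) is |a - b| / (a + b); the scale is A = 1. *)
  exists (1 + tan (x / 2)), (1 - tan (x / 2)).
  repeat split; try lra.
  - unfold arith_mean. field.
  - unfold quad_mean.
    replace (((1 + tan (x / 2)) ^ 2 + (1 - tan (x / 2)) ^ 2) / 2)
      with ((1 / cos (x / 2)) ^ 2).
    + apply sqrt_pow2, Rlt_le, Rdiv_lt_0_compat; lra.
    + unfold tan. pose proof (sin2_cos2_pow (x / 2)).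
      replace ((1 / cos (x / 2)) ^ 2)
        with ((sin (x / 2) ^ 2 + cos (x / 2) ^ 2) / cos (x / 2) ^ 2)
        by (rewrite H; field; lra).
      field. lra.
Qed.

Lemma Rpower_weighted A k t : 0 < A -> 0 < k ->
  Rpower (A / k) t * Rpower A (1 - t) = A * exp (- t * ln k).
Proof.
  intros HA Hk. unfold Rpower.
  rewrite ln_div, <- exp_plus by assumption.
  replace (t * (ln A - ln k) + (1 - t) * ln A) with (ln A + - t * ln k) by ring.
  now rewrite exp_plus, exp_ln.
Qed.

Lemma mean_inequalities_polar A x t u : 0 < A -> 0 < x < PI / 2 ->
  let k := cos (x / 2) in let Q := A / k in let N := neuman_mean A Q in
  (Rpower Q t * Rpower A (1 - t) < N <-> - t * ln k < ln (neuman_ratio x)) /\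
  (N < Rpower Q t * Rpower A (1 - t) <-> ln (neuman_ratio x) < - t * ln k) /\
  (u / A + (1 - u) / Q < 1 / N <-> u + (1 - u) * k < / neuman_ratio x) /\
  (1 / N < u / A + (1 - u) / Q <-> / neuman_ratio x < u + (1 - u) * k).
Proof.
  intros HA Hx k Q N.
  assert (Hk : 0 < k) by (apply cos_gt_0; lra).
  assert (HN : N = A * neuman_ratio x) by (apply neuman_mean_polar; lra).
  pose proof (neuman_ratio_gt_1 x ltac:(lra)) as Hn.
  unfold Q. rewrite Rpower_weighted, HN by assumption.
  replace (u / A + (1 - u) / (A / k)) with (/ A * (u + (1 - u) * k)) by (field; lra).
  replace (1 / (A * neuman_ratio x)) with (/ A * / neuman_ratio x) by (field; lra).
  assert (HA' : 0 < / A) by now apply Rinv_0_lt_compat.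
  assert (Hmul : forall c p q, 0 < c -> c * p < c * q <-> p < q).
  { intros c p q Hc. split; [apply Rmult_lt_reg_l | apply Rmult_lt_compat_l]; lra. }
  rewrite !Hmul by assumption.
  repeat split; auto; intros H.
  - rewrite <- (ln_exp (- t * ln k)). apply ln_increasing; auto. apply exp_pos.
  - rewrite <- (exp_ln (neuman_ratio x)) by lra. now apply exp_increasing.
  - rewrite <- (ln_exp (- t * ln k)). apply ln_increasing; auto. lra.
  - rewrite <- (exp_ln (neuman_ratio x)) by lra. now apply exp_increasing.
Qed.

(** Everything is homogeneous in (a, b), and the angle [x] of [means_polar]
    runs through all of (0, PI / 2).  Taking logarithms in the first
    pair and inverses in the second leaves inequalities between functions of [x]. *)
Lemma mean_inequalities_iff (alpha beta alpha' beta' : R) :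
  (forall a b : R, 0 < a -> 0 < b -> a <> b ->
      (Rpower (quad_mean a b) alpha * Rpower (arith_mean a b) (1 - alpha)
         < N_AQ a b
         < Rpower (quad_mean a b) beta * Rpower (arith_mean a b) (1 - beta))
      /\
      (alpha' / arith_mean a b + (1 - alpha') / quad_mean a b
         < 1 / N_AQ a b
         < beta' / arith_mean a b + (1 - beta') / quad_mean a b))
  <->
  (forall x, 0 < x < PI / 2 ->
      (- alpha * ln (cos (x / 2)) < ln (neuman_ratio x)
         < - beta * ln (cos (x / 2))) /\
      (alpha' + (1 - alpha') * cos (x / 2) < / neuman_ratio x
         < beta' + (1 - beta') * cos (x / 2))).
Proof.
  unfold N_AQ. split; intros H.
  - intros x Hx. destruct (polar_means x Hx) as (a & b & Ha & Hb & Hab & HA & HQ).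
    specialize (H a b Ha Hb Hab). rewrite HA, HQ in H.
    pose proof (mean_inequalities_polar 1 x alpha alpha' Rlt_0_1 Hx) as Hal.
    pose proof (mean_inequalities_polar 1 x beta beta' Rlt_0_1 Hx) as Hbe.
    cbv zeta in *. tauto.
  - intros a b Ha Hb Hab. destruct (means_polar a b Ha Hb Hab) as (x & Hx & HQ).
    specialize (H x Hx). rewrite HQ.
    pose proof (arith_mean_pos a b Ha Hb) as HA.
    pose proof (mean_inequalities_polar _ x alpha alpha' HA Hx) as Hal.
    pose proof (mean_inequalities_polar _ x beta beta' HA Hx) as Hbe.
    cbv zeta in *. tauto.
Qed.

(** * Rational bounds for N/A *)

Lemma cos_half_bounds x : 0 < x < PI / 2 -> / sqrt 2 < cos (x / 2) < 1.
Proof.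
  intros Hx. split.
  - replace (/ sqrt 2) with (cos (PI / 4)) by (rewrite cos_PI4; unfold Rdiv; ring).
    apply cos_decreasing_1; lra.
  - rewrite <- cos_0. apply cos_decreasing_1; lra.
Qed.

Lemma sin_cos_half_ranges x : 0 < x < PI / 2 ->
  0 < sin x /\ 0 < cos x < 1 /\ 7 / 10 < cos (x / 2) < 1 /\ 0 < sin (x / 2).
Proof.
  intros Hx. pose proof (cos_half_bounds x Hx). pose proof inv_sqrt2_bounds.
  pose proof (half_cos_sqr x).
  assert (0 < sin x) by (apply sin_pos; lra).
  assert (0 < cos x) by (apply cos_gt_0; lra).
  assert (0 < sin (x / 2)) by (apply sin_pos; lra).
  repeat split; nra.
Qed.

Lemma neuman_ratio_upper x : 0 < x < PI / 2 ->
  neuman_ratio x * (4 * cos (x / 2) ^ 2 - 1) < 3 * cos (x / 2) ^ 2.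
Proof.
  intros Hx. pose proof (sin_cos_half_ranges x Hx).
  pose proof (sin_lower x ltac:(lra)) as Hl. rewrite half_cos_sqr in Hl.
  unfold neuman_ratio.
  set (k := cos (x / 2)) in *.
  assert (x / sin x * (4 * k ^ 2 - 1) < 2 * k ^ 2 + 1); [|lra].
  replace (x / sin x * (4 * k ^ 2 - 1)) with (x * (4 * k ^ 2 - 1) / sin x)
    by (field; lra).
  apply <- Rlt_div_l; lra.
Qed.

Lemma neuman_ratio_lower x : 0 < x < PI / 2 ->
  2 + cos (x / 2) ^ 2 < neuman_ratio x * (1 + 2 * cos (x / 2) ^ 2).
Proof.
  intros Hx. pose proof (sin_cos_half_ranges x Hx).
  pose proof (cusa_huygens x ltac:(lra)) as Hl. rewrite half_cos_sqr in Hl.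
  unfold neuman_ratio.
  set (k := cos (x / 2)) in *.
  assert (3 < x / sin x * (1 + 2 * k ^ 2)); [|lra].
  replace (x / sin x * (1 + 2 * k ^ 2)) with (x * (1 + 2 * k ^ 2) / sin x)
    by (field; lra).
  apply -> Rlt_div_r; lra.
Qed.

Lemma sin_half_sqr_le x : 0 < x < PI -> sin (x / 2) ^ 2 <= x ^ 2 / 4.
Proof.
  intros Hx. pose proof (sin_lt_x (x / 2) ltac:(lra)).
  pose proof (sin_pos (x / 2) ltac:(lra)). nra.
Qed.

(** With k = cos (x/2), [neuman_ratio_upper] gives N/A <= 2 - k^2, because
    (2 - k^2) (4 k^2 - 1) - 3 k^2 = 2 (1 - k^2) (2 k^2 - 1), and
    1 - k^2 = sin (x/2) ^ 2. *)
Lemma neuman_ratio_le_quadratic x : 0 < x < PI / 2 -> neuman_ratio x <= 1 + x ^ 2 / 4.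
Proof.
  intros Hx. pose proof (sin_cos_half_ranges x Hx).
  pose proof (neuman_ratio_upper x Hx) as Hu.
  pose proof (sin_half_sqr_le x ltac:(lra)).
  pose proof (sin2_cos2_pow (x / 2)).
  pose proof (half_cos_sqr x).
  set (k := cos (x / 2)) in *.
  assert (neuman_ratio x <= 2 - k ^ 2); [|lra].
  apply Rmult_le_reg_r with (4 * k ^ 2 - 1); [nra|].
  assert (0 <= (1 - k ^ 2) * (2 * k ^ 2 - 1)) by nra. nra.
Qed.

Lemma neuman_ratio_cvg_1 eps : 0 < eps ->
  exists d, 0 < d /\ forall x, 0 < x < d -> x < PI / 2 /\ neuman_ratio x < 1 + eps.
Proof.
  intros He. pose proof PI_approx. exists (Rmin 1 eps).
  assert (Hm : 0 < Rmin 1 eps) by (apply Rmin_pos; lra).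
  split; auto. intros x Hx.
  pose proof (Rmin_l 1 eps). pose proof (Rmin_r 1 eps).
  split; [lra|].
  pose proof (neuman_ratio_le_quadratic x ltac:(lra)). nra.
Qed.

Lemma ln_le_sub1 y : 0 < y -> ln y <= y - 1.
Proof.
  intros Hy. pose proof (exp_ineq1_le (ln y)) as H. rewrite exp_ln in H; lra.
Qed.

Lemma ln_ge_1_sub_inv y : 0 < y -> 1 - / y <= ln y.
Proof.
  intros Hy. pose proof (ln_le_sub1 (/ y) ltac:(now apply Rinv_0_lt_compat)) as H.
  rewrite ln_Rinv in H; lra.
Qed.

Lemma ln_cos_half_lower x : 0 < x < PI / 2 -> - (x ^ 2 / 4) <= ln (cos (x / 2)).
Proof.
  intros Hx. pose proof (sin_cos_half_ranges x Hx).
  pose proof (ln_ge_1_sub_inv (cos (x / 2)) ltac:(lra)).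
  pose proof (sin_half_sqr_le x ltac:(lra)).
  pose proof (sin2_cos2_pow (x / 2)).
  set (k := cos (x / 2)) in *.
  assert (/ k <= 2 - k ^ 2); [|lra].
  apply Rmult_le_reg_r with k; [lra|]. rewrite Rinv_l by lra.
  assert (0 <= (1 - k) * (k + k ^ 2 - 1)) by nra. nra.
Qed.

(** * Values at the right end of the range *)

Lemma half_PI_values :
  cos (PI / 2 / 2) = / sqrt 2 /\ neuman_ratio (PI / 2) = (PI + 2) / 4 /\
  ln (/ sqrt 2) = - (ln 2 / 2).
Proof.
  pose proof sqrt2_approx. repeat split.
  - replace (PI / 2 / 2) with (PI / 4) by field. rewrite cos_PI4. unfold Rdiv. ring.
  - unfold neuman_ratio. rewrite sin_PI2. field.
  - rewrite ln_Rinv by lra. rewrite <- Rpower_sqrt by lra. unfold Rpower.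
    rewrite ln_exp. field.
Qed.

(** At [x = PI / 2] one has Q/A = sqrt 2 and N/A = (PI + 2) / 4, the limit case
    b = 0; this is where [log_exponent_sup] comes from. *)
Lemma log_gap_at_half_PI t :
  ln (neuman_ratio (PI / 2)) + t * ln (cos (PI / 2 / 2))
  = ln 2 / 2 * (log_exponent_sup - t).
Proof.
  unfold log_exponent_sup.
  destruct half_PI_values as (-> & -> & ->).
  pose proof PI_approx. pose proof ln2_pos.
  rewrite ln_div by lra. replace (ln 4) with (2 * ln 2).
  - field. lra.
  - replace 4 with (2 * 2) by ring. rewrite ln_mult by lra. ring.
Qed.

(** The same limit case for the second pair of inequalities. *)
Lemma recip_gap_at_half_PI u :
  u + (1 - u) * cos (PI / 2 / 2) - / neuman_ratio (PI / 2)
  = (1 - / sqrt 2) * (u - recip_weight_inf).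
Proof.
  unfold recip_weight_inf.
  destruct half_PI_values as (-> & -> & _).
  pose proof PI_approx. pose proof sqrt2_approx.
  assert (sqrt 2 * sqrt 2 = 2) by (apply sqrt_def; lra).
  assert (Hr : / sqrt 2 = sqrt 2 / 2).
  { apply Rmult_eq_reg_r with (sqrt 2); [|lra]. rewrite Rinv_l by lra. lra. }
  rewrite Hr. apply Rmult_eq_reg_r with (PI + 2); [|lra].
  replace ((1 - sqrt 2 / 2) * (u - (6 + 2 * sqrt 2 - (1 + sqrt 2) * PI) / (PI + 2)) * (PI + 2)) with
    ((1 - sqrt 2 / 2) * (u * (PI + 2) - (6 + 2 * sqrt 2 - (1 + sqrt 2) * PI)))
    by (field; lra).
  replace ((u + (1 - u) * (sqrt 2 / 2) - / ((PI + 2) / 4)) * (PI + 2)) with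
    ((u + (1 - u) * (sqrt 2 / 2)) * (PI + 2) - 4) by (field; lra).
  nra.
Qed.

(** * Bounds by weighted geometric means *)

Lemma is_derive_ln_neuman_ratio x : 0 < x < PI ->
  is_derive (fun y => ln (neuman_ratio y)) x
    ((sin x - x * cos x) / (sin x * (sin x + x))).
Proof.
  intros Hx. pose proof (sin_pos x Hx).
  assert (0 < x / sin x) by (apply Rdiv_lt_0_compat; lra).
  unfold neuman_ratio. auto_derive.
  - repeat split; unfold Rdiv in *; lra.
  - field. repeat split; nra.
Qed.

Lemma is_derive_ln_cos_half x : 0 < x < PI ->
  is_derive (fun y => ln (cos (y / 2))) x (- ((1 - cos x) / (2 * sin x))).
Proof.
  intros Hx.
  assert (0 < cos (x / 2)) by (apply cos_gt_0; lra).
  pose proof (sin_pos (x / 2) ltac:(lra)).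
  auto_derive; [assumption|].
  pose proof (half_cos_sqr x). pose proof (sin2_cos2_pow (x / 2)).
  replace (1 - cos x) with (2 * sin (x / 2) ^ 2) by lra.
  rewrite (half_sin_cos x). change (x * / 2) with (x / 2). field. lra.
Qed.

(** The quotient of the derivatives of [ln (N/A)] and [ln (Q/A)]. *)
Definition log_slope x := 2 * (sin x - x * cos x) / ((1 - cos x) * (sin x + x)).

Lemma is_derive_ln_neuman_ratio_add t x : 0 < x < PI ->
  is_derive (fun y => ln (neuman_ratio y) + t * ln (cos (y / 2))) x
    ((1 - cos x) / (2 * sin x) * (log_slope x - t)).
Proof.
  intros Hx. pose proof (sin_pos x Hx).
  assert (cos x < 1) by (rewrite <- cos_0; apply cos_decreasing_1; lra).
  replace (_ * (_ - t)) with
    (plus ((sin x - x * cos x) / (sin x * (sin x + x)))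
       (t * - ((1 - cos x) / (2 * sin x))))
    by (unfold log_slope, plus; simpl; field; lra).
  apply (is_derive_plus (fun y => ln (neuman_ratio y)) (fun y => t * ln (cos (y / 2)))).
  - now apply is_derive_ln_neuman_ratio.
  - apply is_derive_scal. now apply is_derive_ln_cos_half.
Qed.

(** The numerator of the derivative of [log_slope].  With r = sin x / x it is
    concave in r and positive at r = 0; at the Cusa-Huygens bound
    r = (2 + cos x) / 3 it equals (1 - cos x)^2 / 9, up to the factor x^2. *)
Lemma log_slope_numerator_pos x : 0 < x < PI / 2 ->
  0 < x ^ 2 + x * sin x * cos x - 2 * sin x ^ 2.
Proof.
  intros Hx. pose proof (cusa_ratio x ltac:(lra)) as Hr.
  pose proof (sin_cos_half_ranges x Hx).
  set (r := sin x / x) in *.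
  replace (sin x) with (r * x) by (unfold r; field; lra).
  set (c := cos x) in *.
  replace (x ^ 2 + x * (r * x) * c - 2 * (r * x) ^ 2)
    with (x ^ 2 * (1 + c * r - 2 * r ^ 2)) by ring.
  apply Rmult_lt_0_compat; [nra|].
  assert (2 * r ^ 2 < r * (2 * ((2 + c) / 3))) by nra.
  nra.
Qed.

Lemma log_slope_incr x y : 0 < x -> x < y -> y < PI / 2 -> log_slope x < log_slope y.
Proof.
  apply (incr_of_derive_pos _ (fun z =>
    2 * sin z * (z ^ 2 + z * sin z * cos z - 2 * sin z ^ 2)
      / ((1 - cos z) * (sin z + z)) ^ 2)); intros z Hz;
    pose proof (sin_cos_half_ranges z Hz);
    assert (HD : 0 < (1 - cos z) * (sin z + z)) by nra.
  - replace (_ / _) with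
      ((2 * (z * sin z) * ((1 - cos z) * (sin z + z))
        - 2 * (sin z - z * cos z) * (sin z * (2 * sin z + z)))
       / ((1 - cos z) * (sin z + z)) ^ 2) by (field; nra).
    apply (is_derive_div (fun z => 2 * (sin z - z * cos z))
             (fun z => (1 - cos z) * (sin z + z))); [| |lra].
    + auto_derive; auto. ring.
    + auto_derive; auto. pose proof (sin2_cos2_pow z). nra.
  - pose proof (log_slope_numerator_pos z Hz).
    apply Rdiv_lt_0_compat; [|nra].
    apply Rmult_lt_0_compat; lra.
Qed.

(** The difference of the two sides increases, since [2 / 3 < log_slope] is
    exactly [sin_lower], and it starts from 0. *)
Lemma log_lower_bound x : 0 < x < PI / 2 ->
  - (2 / 3) * ln (cos (x / 2)) < ln (neuman_ratio x).
Proof.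
  intros Hx.
  enough (0 < ln (neuman_ratio x) + 2 / 3 * ln (cos (x / 2))) by lra.
  apply (pos_of_incr (fun y => ln (neuman_ratio y) + 2 / 3 * ln (cos (y / 2))) (PI / 2)); auto.
  - intros a b Ha Hab Hb.
    apply (incr_of_derive_pos (fun y => ln (neuman_ratio y) + 2 / 3 * ln (cos (y / 2)))
      (fun z => (1 - cos z) / (2 * sin z) * (log_slope z - 2 / 3)) (PI / 2)); auto;
      intros z Hz.
    + apply is_derive_ln_neuman_ratio_add; lra.
    + pose proof (sin_cos_half_ranges z Hz). pose proof (sin_lower z ltac:(lra)).
      apply Rmult_lt_0_compat; [apply Rdiv_lt_0_compat; lra|].
      apply Rlt_0_minus. unfold log_slope. apply -> Rlt_div_r; nra.
  - intros eps He. pose proof PI_approx. exists (Rmin 1 eps).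
    split; [apply Rmin_pos; lra|]. intros y Hy.
    pose proof (Rmin_l 1 eps). pose proof (Rmin_r 1 eps).
    pose proof (ln_cos_half_lower y ltac:(lra)).
    assert (0 < ln (neuman_ratio y)).
    { rewrite <- ln_1. apply ln_increasing; [lra|]. apply neuman_ratio_gt_1; lra. }
    nra.
Qed.

(** The logarithm of N/A over its bound vanishes at [PI / 2] by the choice of the
    exponent and tends to 0 at 0, and its derivative crosses 0 once. *)
Lemma log_upper_bound x : 0 < x < PI / 2 ->
  ln (neuman_ratio x) < - log_exponent_sup * ln (cos (x / 2)).
Proof.
  intros Hx.
  enough (ln (neuman_ratio x) + log_exponent_sup * ln (cos (x / 2)) < 0) by lra.
  apply (neg_of_single_crossing
    (fun y => ln (neuman_ratio y) + log_exponent_sup * ln (cos (y / 2)))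
    (fun y => (1 - cos y) / (2 * sin y)) log_slope log_exponent_sup (PI / 2)); auto.
  - intros y Hy. apply is_derive_ln_neuman_ratio_add; lra.
  - intros y Hy. pose proof (sin_cos_half_ranges y Hy). apply Rdiv_lt_0_compat; lra.
  - apply log_slope_incr.
  - intros eps He. destruct (neuman_ratio_cvg_1 eps He) as (d & Hd & Hn).
    exists d. split; auto. intros y Hy. destruct (Hn y Hy) as [Hy2 Hny].
    pose proof (sin_cos_half_ranges y ltac:(lra)).
    pose proof (neuman_ratio_gt_1 y ltac:(lra)).
    pose proof (ln_le_sub1 (neuman_ratio y) ltac:(lra)).
    pose proof (ln_le_sub1 (cos (y / 2)) ltac:(lra)).
    pose proof log_exponent_sup_bounds. nra.
  - rewrite log_gap_at_half_PI. ring.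
Qed.

(** * Bounds by weighted harmonic means *)

(** The numerator of the derivative of [recip_slope].  As in
    [log_slope_numerator_pos], it is concave in r = sin x / x, and at the
    Cusa-Huygens bound it equals 4 (1 - cos x)^2 / 9, up to the factor x^2. *)
Lemma recip_slope_numerator_pos x : 0 < x < PI / 2 ->
  0 < x ^ 2 * (2 - cos x) + x * sin x * (1 + 3 * cos x) - 5 * sin x ^ 2.
Proof.
  intros Hx. pose proof (cusa_ratio x ltac:(lra)) as Hr.
  pose proof (sin_cos_half_ranges x Hx).
  set (r := sin x / x) in *.
  replace (sin x) with (r * x) by (unfold r; field; lra).
  set (c := cos x) in *.
  replace (x ^ 2 * (2 - c) + x * (r * x) * (1 + 3 * c) - 5 * (r * x) ^ 2)
    with (x ^ 2 * (2 - c + r * (1 + 3 * c) - 5 * r ^ 2)) by ring.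
  apply Rmult_lt_0_compat; [nra|].
  assert (5 * r ^ 2 < r * (5 * ((2 + c) / 3))) by nra.
  nra.
Qed.

(** Equals (1 - u) / 4 for the weight u at which u + (1 - u) cos (x/2) and A/N
    have the same derivative; see [is_derive_recip_gap]. *)
Definition recip_slope x := (sin x - x * cos x) / ((sin x + x) ^ 2 * sin (x / 2)).

Lemma recip_slope_incr x y : 0 < x -> x < y -> y < PI / 2 -> recip_slope x < recip_slope y.
Proof.
  apply (incr_of_derive_pos _ (fun z =>
    (1 + cos z) * (z ^ 2 * (2 - cos z) + z * sin z * (1 + 3 * cos z) - 5 * sin z ^ 2)
      / (2 * sin z * (sin z + z) ^ 3 * sin (z / 2)))); intros z Hz;
    pose proof (sin_cos_half_ranges z Hz);
    assert (HD2 : 0 < (sin z + z) ^ 2) by nra;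
    assert (HD : 0 < (sin z + z) ^ 2 * sin (z / 2)) by nra.
  - replace (_ / _) with
      ((z * ((1 - cos z) * (1 + cos z) / sin z) * ((sin z + z) ^ 2 * sin (z / 2))
        - (sin z - z * cos z)
          * (sin (z / 2) * (1 + cos z) * (sin z + z) * (5 * sin z + z) / (2 * sin z)))
       / ((sin z + z) ^ 2 * sin (z / 2)) ^ 2) by (field; nra).
    apply (is_derive_div (fun z => sin z - z * cos z)
             (fun z => (sin z + z) ^ 2 * sin (z / 2))); [| |lra].
    + auto_derive; auto. pose proof (sin2_cos2_pow z).
      replace ((1 - cos z) * (1 + cos z)) with (sin z ^ 2) by lra. field. lra.
    + auto_derive; auto. change (z * / 2) with (z / 2).
      replace (cos (z / 2)) with (sin (z / 2) * (1 + cos z) / sin z).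
      * field. lra.
      * rewrite (half_cos_sqr z), (half_sin_cos z). field. lra.
  - pose proof (recip_slope_numerator_pos z Hz).
    apply Rdiv_lt_0_compat; [apply Rmult_lt_0_compat; lra|].
    assert (0 < (sin z + z) ^ 3) by (apply pow_lt; lra).
    repeat apply Rmult_lt_0_compat; lra.
Qed.

Lemma is_derive_recip_gap u x : 0 < x < PI ->
  is_derive (fun y => u + (1 - u) * cos (y / 2) - / neuman_ratio y) x
    (2 * sin (x / 2) * (recip_slope x - (1 - u) / 4)).
Proof.
  intros Hx. pose proof (sin_pos x Hx).
  pose proof (sin_pos (x / 2) ltac:(lra)).
  pose proof (neuman_ratio_gt_1 x Hx) as Hn.
  unfold neuman_ratio in *. auto_derive.
  - repeat split; unfold Rdiv in *; lra.
  - unfold recip_slope. change (x * / 2) with (x / 2). field. repeat split; nra.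
Qed.

(** As for [log_upper_bound], with [recip_slope] as the increasing function. *)
Lemma recip_lower_bound x : 0 < x < PI / 2 ->
  recip_weight_inf + (1 - recip_weight_inf) * cos (x / 2) < / neuman_ratio x.
Proof.
  intros Hx. apply Rminus_lt.
  apply (neg_of_single_crossing
    (fun y => recip_weight_inf + (1 - recip_weight_inf) * cos (y / 2) - / neuman_ratio y)
    (fun y => 2 * sin (y / 2)) recip_slope ((1 - recip_weight_inf) / 4) (PI / 2)); auto.
  - intros y Hy. apply is_derive_recip_gap; lra.
  - intros y Hy. pose proof (sin_cos_half_ranges y Hy). lra.
  - apply recip_slope_incr.
  - intros eps He. destruct (neuman_ratio_cvg_1 eps He) as (d & Hd & Hn).
    exists d. split; auto. intros y Hy. destruct (Hn y Hy) as [Hy2 Hny].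
    pose proof (sin_cos_half_ranges y ltac:(lra)).
    pose proof (neuman_ratio_gt_1 y ltac:(lra)).
    pose proof recip_weight_inf_bounds.
    assert (1 - eps < / neuman_ratio y).
    { apply Rmult_lt_reg_r with (neuman_ratio y); [lra|]. rewrite Rinv_l by lra. nra. }
    nra.
  - rewrite recip_gap_at_half_PI. ring.
Qed.

(** With k = cos (x/2), replacing N/A by its Cusa-Huygens lower bound reduces the
    claim to (1 - k)^2 (2 k - 1) > 0. *)
Lemma recip_upper_bound x : 0 < x < PI / 2 ->
  / neuman_ratio x < 1 / 3 + (1 - 1 / 3) * cos (x / 2).
Proof.
  intros Hx. pose proof (sin_cos_half_ranges x Hx).
  pose proof (neuman_ratio_gt_1 x ltac:(lra)).
  pose proof (neuman_ratio_lower x Hx).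
  set (k := cos (x / 2)) in *. set (n := neuman_ratio x) in *.
  apply Rmult_lt_reg_l with n; [lra|]. rewrite Rinv_r by lra.
  apply Rmult_lt_reg_r with (1 + 2 * k ^ 2); [nra|].
  assert (0 < (1 - k) ^ 2 * (2 * k - 1)) by (apply Rmult_lt_0_compat; nra).
  assert ((2 + k ^ 2) * (1 / 3 + (1 - 1 / 3) * k)
            < n * (1 + 2 * k ^ 2) * (1 / 3 + (1 - 1 / 3) * k))
    by (apply Rmult_lt_compat_r; lra).
  nra.
Qed.

(** * Sharpness of the constants *)

Lemma cos_half_surj k : 3 / 4 < k < 1 -> exists x, 0 < x < PI / 2 /\ cos (x / 2) = k.
Proof.
  intros Hk. pose proof inv_sqrt2_bounds.
  assert (Hcos : cos (acos k) = k) by (apply cos_acos; lra).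
  pose proof (acos_bound k).
  exists (2 * acos k). replace (2 * acos k / 2) with (acos k) by field.
  split; auto.
  assert (acos k <> 0) by (intros E; rewrite E, cos_0 in Hcos; lra).
  assert (acos k < PI / 4); [|lra].
  pose proof PI_RGT_0. apply cos_decreasing_0; try lra.
  rewrite Hcos, cos_PI4. unfold Rdiv. lra.
Qed.

(** With k = cos (x/2), [sin_lower] gives ln (N/A) <= (1 - k^2) / (4 k^2 - 1),
    while -t ln k >= t (1 - k^2) / 2; hence t (4 k^2 - 1) < 2, and k tends to 1. *)
Lemma log_lower_sharp t :
  (forall x, 0 < x < PI / 2 -> - t * ln (cos (x / 2)) < ln (neuman_ratio x)) -> t <= 2 / 3.
Proof.
  intros Ht. destruct (Rle_lt_dec t (2 / 3)) as [|Hgt]; auto. exfalso.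
  (* At k = 1 - e/2 one has k^2 >= 1 - e, so t (4 k^2 - 1) >= 3 t - 4 t e, which is
     at least 2 t + 2/3 > 2. *)
  set (e := Rmin (/ 4) ((t - 2 / 3) / (4 * t))).
  assert (He : 0 < e) by (apply Rmin_pos; [|apply Rdiv_lt_0_compat]; lra).
  assert (He1 : e <= / 4) by apply Rmin_l.
  assert (He2 : 4 * t * e <= t - 2 / 3).
  { assert (H : e <= (t - 2 / 3) / (4 * t)) by apply Rmin_r.
    apply <- Rle_div_r in H; lra. }
  destruct (cos_half_surj (1 - e / 2) ltac:(lra)) as (x & Hx & Hk).
  pose proof (neuman_ratio_upper x Hx) as Hu.
  pose proof (neuman_ratio_gt_1 x ltac:(lra)).
  specialize (Ht x Hx).
  rewrite Hk in *. set (k := 1 - e / 2) in *. set (n := neuman_ratio x) in *.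
  assert (Hk1 : 3 / 4 < k < 1) by (unfold k; lra).
  pose proof (ln_le_sub1 n ltac:(lra)).
  pose proof (ln_le_sub1 (k ^ 2) ltac:(nra)) as Hlk.
  rewrite ln_pow in Hlk by lra. simpl INR in Hlk.
  assert (H1 : t / 2 * (1 - k ^ 2) < n - 1) by nra.
  assert (H2 : (n - 1) * (4 * k ^ 2 - 1) < 1 - k ^ 2) by nra.
  assert (H3 : t / 2 * (4 * k ^ 2 - 1) < 1).
  { apply Rmult_lt_reg_r with (1 - k ^ 2); [nra|].
    apply Rle_lt_trans with ((n - 1) * (4 * k ^ 2 - 1)); [|lra].
    replace (t / 2 * (4 * k ^ 2 - 1) * (1 - k ^ 2))
      with (t / 2 * (1 - k ^ 2) * (4 * k ^ 2 - 1)) by ring.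
    apply Rmult_le_compat_r; nra. }
  unfold k in H3. nra.
Qed.

(** Let [x] tend to [PI / 2]. *)
Lemma log_upper_sharp t :
  (forall x, 0 < x < PI / 2 -> ln (neuman_ratio x) < - t * ln (cos (x / 2))) ->
  log_exponent_sup <= t.
Proof.
  intros Ht. pose proof PI_RGT_0. pose proof ln2_pos.
  enough (ln 2 / 2 * (log_exponent_sup - t) <= 0) by nra.
  rewrite <- log_gap_at_half_PI.
  apply (nonpos_at_endpoint (fun y => ln (neuman_ratio y) + t * ln (cos (y / 2)))
           (PI / 2) _ ltac:(lra) (is_derive_ln_neuman_ratio_add t (PI / 2) ltac:(lra))).
  intros x Hx. specialize (Ht x Hx). lra.
Qed.

Lemma recip_lower_sharp u :
  (forall x, 0 < x < PI / 2 -> u + (1 - u) * cos (x / 2) < / neuman_ratio x) ->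
  u <= recip_weight_inf.
Proof.
  intros Hu. pose proof PI_RGT_0. pose proof inv_sqrt2_bounds.
  enough ((1 - / sqrt 2) * (u - recip_weight_inf) <= 0) by nra.
  rewrite <- recip_gap_at_half_PI.
  apply (nonpos_at_endpoint (fun y => u + (1 - u) * cos (y / 2) - / neuman_ratio y)
           (PI / 2) _ ltac:(lra) (is_derive_recip_gap u (PI / 2) ltac:(lra))).
  intros x Hx. specialize (Hu x Hx). lra.
Qed.

(** With k = cos (x/2), [sin_lower] gives (4 k^2 - 1) / (3 k^2) < A/N.
    Since 4 k^2 - 1 - 3 k^3 = (1 - k) (3 k^2 - k - 1), a factor 1 - k cancels and
    leaves 3 k^2 - k - 1 < 3 k^2 u; then k tends to 1. *)
Lemma recip_upper_sharp u :
  (forall x, 0 < x < PI / 2 -> / neuman_ratio x < u + (1 - u) * cos (x / 2)) -> 1 / 3 <= u.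
Proof.
  intros Hu. destruct (Rle_lt_dec (1 / 3) u) as [|Hlt]; auto. exfalso.
  (* At k = 1 - e one has 3 k^2 - k - 1 >= 1 - 5 e, which is at least 0 and at
     least u + 2/3. *)
  set (e := Rmin (/ 5) ((1 / 3 - u) / 5)).
  assert (He : 0 < e) by (apply Rmin_pos; lra).
  assert (He1 : e <= / 5) by apply Rmin_l.
  assert (He2 : e <= (1 / 3 - u) / 5) by apply Rmin_r.
  destruct (cos_half_surj (1 - e) ltac:(lra)) as (x & Hx & Hk).
  pose proof (neuman_ratio_upper x Hx) as Hn.
  pose proof (neuman_ratio_gt_1 x ltac:(lra)).
  specialize (Hu x Hx).
  rewrite Hk in *. set (n := neuman_ratio x) in *.
  assert (Hk1 : 3 / 4 < 1 - e < 1) by lra.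
  set (k := 1 - e) in *.
  assert (H1 : 4 * k ^ 2 - 1 < 3 * k ^ 2 * (u + (1 - u) * k)).
  { apply Rlt_le_trans with (3 * k ^ 2 * / n).
    - apply Rmult_lt_reg_l with n; [lra|].
      replace (n * (3 * k ^ 2 * / n)) with (3 * k ^ 2) by (field; lra). lra.
    - apply Rmult_le_compat_l; nra. }
  assert (H2 : 3 * k ^ 2 - k - 1 < 3 * k ^ 2 * u).
  { apply Rmult_lt_reg_r with (1 - k); [lra|]. nra. }
  unfold k in *. nra.
Qed.

(** * The optimal constants *)

Theorem theorem3p3 (alpha5 beta5 alpha6 beta6 : R) :
  ((forall a b : R, 0 < a -> 0 < b -> a <> b ->
      (Rpower (quad_mean a b) alpha5 * Rpower (arith_mean a b) (1 - alpha5)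
         < N_AQ a b
         < Rpower (quad_mean a b) beta5 * Rpower (arith_mean a b) (1 - beta5))
      /\
      (alpha6 / arith_mean a b + (1 - alpha6) / quad_mean a b
         < 1 / N_AQ a b
         < beta6 / arith_mean a b + (1 - beta6) / quad_mean a b))
   <->
   (alpha5 <= 2 / 3 /\
    beta5 >= 2 * ln (PI + 2) / ln 2 - 4 /\
    alpha6 <= (6 + 2 * sqrt 2 - (1 + sqrt 2) * PI) / (PI + 2) /\
    beta6 >= 1 / 3))
  /\ 7244 / 10000 <= 2 * ln (PI + 2) / ln 2 - 4 < 7245 / 10000
  /\ 2419 / 10000 <= (6 + 2 * sqrt 2 - (1 + sqrt 2) * PI) / (PI + 2)
       < 2420 / 10000.
Proof.
  fold log_exponent_sup recip_weight_inf.
  split; [|split; [apply log_exponent_sup_bounds | apply recip_weight_inf_bounds]].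
  rewrite mean_inequalities_iff. split.
  - intros H. repeat split.
    + apply log_lower_sharp. intros x Hx. apply (H x Hx).
    + apply Rle_ge, log_upper_sharp. intros x Hx. apply (H x Hx).
    + apply recip_lower_sharp. intros x Hx. apply (H x Hx).
    + apply Rle_ge, recip_upper_sharp. intros x Hx. apply (H x Hx).
  - intros (Ha5 & Hb5 & Ha6 & Hb6) x Hx.
    pose proof (log_lower_bound x Hx). pose proof (log_upper_bound x Hx).
    pose proof (recip_lower_bound x Hx). pose proof (recip_upper_bound x Hx).
    pose proof (sin_cos_half_ranges x Hx).
    (* Both families of bounds are monotone in their parameter, because
       Q/A > 1, that is, ln (cos (x/2)) < 0 and cos (x/2) < 1. *)
    pose proof (ln_le_sub1 (cos (x / 2)) ltac:(lra)).
    repeat split; nra.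
Qed.
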